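(* Let $\mathbf{V}_{\mathsf{hypo}}$ be the monoid variety generated by the hypoplactic monoid $\mathsf{hypo}$. Then $\mathbf{V}_{\mathsf{hypo}}$ admits a finite basis $\mathcal{B}_{\mathsf{hypo}}$ consisting of the following identities (in variables $x,y,z,t$): $$xyzxty \approx yxzxty, \qquad xzxytx \approx xzyxtx, \qquad xzytxy \approx xzytyx.$$
   Context: Let $\mathcal{A} = \{1<2<3<\cdots\}$ be the ordered alphabet of positive integers. For a word $w$, $|w|_a$ is the number of occurrences of the letter $a$; the content of $w$ is the tuple $(|w|_a)_a$, and the support $\mathrm{supp}(w)$ is the set of letters occurring in $w$. A quasi-ribbon tableau is a finite grid of cells, aligned so that the leftmost cell in each row is below the rightmost cell of the previous row, filled with letters of $\mathcal{A}$ so that rows weakly increase from left to right and columns strictly increase from top to bottom. Krob--Thibon insertion of a letter $a$ into a quasi-ribbon tableau $T$: if no entry of $T$ is $\le a$, create a new cell $a$ and glue $T$ by its top-leftmost entry to the bottom of this cell; otherwise, let $x$ be the right-most and bottom-most entry of $T$ with $x \le a$, separate $T$ just after $x$, put a new entry $a$ to the right of $x$ and glue the remaining part of $T$ (below and to the right of $x$) onto the bottom of the new entry $a$. For $u \in \mathcal{A}^*$, $\mathrm{P}_{\mathsf{hypo}}(u)$ is the tableau obtained from the empty tableau by inserting the letters of $u$ from left to right. The hypoplactic congruence is: $u \equiv_{\mathsf{hypo}} v$ iff $\mathrm{P}_{\mathsf{hypo}}(u) = \mathrm{P}_{\mathsf{hypo}}(v)$. The hypoplactic monoid is $\mathsf{hypo}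 = \mathcal{A}^*/{\equiv_{\mathsf{hypo}}}$. Known equivalent description (Novelli): $u \equiv_{\mathsf{hypo}} v$ iff $u$ and $v$ have the same content and the same inversions, where, if $\mathrm{supp}(u) = \{a_1<\dots<a_k\}$, $u$ has an $a_{i+1}$-$a_i$ inversion ($1 \le i \le k-1$) iff $a_{i+1}a_i$ is a (scattered) subsequence of $u$. A (monoid) identity over an (infinite) alphabet of variables $X$ is a formal equality $u \approx v$ with $u,v \in X^*$. A monoid $M$ satisfies $u \approx v$ if $\psi(u) = \psi(v)$ for every monoid homomorphism $\psi: X^* \to M$. An identity $u \approx v$ is a consequence of a set $\Sigma$ of identities if there are words $u = w_1, \dots, w_k = v$ in $X^*$ and endomorphisms $\sigma_1,\dots,\sigma_{k-1}$ of $X^*$ (variables may be sent to the empty word) such that, for $1 \le i < k$, $w_i = r_i\sigma_i(p_i)s_i$ and $w_{i+1} = r_i\sigma_i(q_i)s_i$ for some $p_i,q_i,r_i,s_i \in X^*$ with $p_i \approx q_i$ or $q_i \approx p_i$ in $\Sigma$. A monoid variety is a class of monoids closed under homomorphic images, submonoids and direct products; the variety generated by $M$ is the smallest one containing $M$, and its equational theory (the set of identities satisfied by all its members) is the set of identities satisfied by $M$. A set $\mathcal{B}$ of identities is a basis of a variety $\mathbf{V}$ if the equational theory of $\mathbf{V}$ consists of all consequences of $\mathcal{B}$. *)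

(* Defs.v *)
From HB Require Import structures.
From mathcomp Require Import all_boot all_order.
From mathcomp Require Import boolp classical_sets cardinality.

Set Implicit Arguments.
Unset Strict Implicit.
Unset Printing Implicit Defensive.

Import Order.TTheory.

Section Tableaux.
Local Open Scope order_scope.
Variables (d : Order.disp_t) (A : orderType d).
Implicit Types (a x y z : A) (r s u v w : seq A) (T : seq (seq A)) (br : rel A).

(* A quasi-ribbon tableau is given by its rows, from top to bottom. Each row
   starts below the last cell of the row above it, so the shape is determined
   by the row lengths, and the only columns with several cells come from the
   contact between two consecutive rows. *)
Definition row_above r r' : bool :=
  if (r, r') is (x :: s, y :: _) then last x s < y else false.

Definition quasi_ribbon T : bool :=
  [&& [::] \notin T, all (sorted <=%O) T & sorted row_above T].

(* The recursion looks for the last row containing an entry <= a, or stops at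
   the top row if there is none; that row is cut just after its last entry <= a
   (at the beginning if there is none), and the entries cut off form a new row
   below a. *)
Fixpoint KT_insert T a : seq (seq A) :=
  if T is r :: T' then
    if has (has (<= a)) T' then r :: KT_insert T' a
    else
      let k := find (> a) r in
      rcons (take k r) a :: (if drop k r is [::] then T' else drop k r :: T')
  else [:: [:: a]].

Definition P_hypo u : seq (seq A) := foldl KT_insert [::] u.

Definition hypo_cong : rel (seq A) := fun u v => P_hypo u == P_hypo v.

Definition inversion u x y : bool := (x < y) && subseq [:: y; x] u.

Definition consecutive u x y : bool :=
  [&& x \in u, y \in u, x < y & all (fun z => (z <= x) || (y <= z)) u].

Definition cons_cell x T := if T is r :: T' then (x :: r) :: T' else [:: [:: x]].

Definition breaks (br : rel A) x s := if s is y :: _ then br x y else false.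

Fixpoint ribbon (br : rel A) s : seq (seq A) :=
  if s is x :: s' then
    if breaks br x s' then [:: x] :: ribbon br s' else cons_cell x (ribbon br s')
  else [::].

Fixpoint sorted_insert a s :=
  if s is y :: s' then if y <= a then y :: sorted_insert a s' else a :: s
  else [:: a].

Lemma flatten_ribbon br s : flatten (ribbon br s) = s.
Proof.
elim: s => //= x s IH; case: ifP => _ /=; first by rewrite IH.
by case: (ribbon br s) IH => [|r T] /= <-.
Qed.

Lemma ribbon_nonempty br s : [::] \notin ribbon br s.
Proof.
elim: s => //= x s IH; case: ifP => _; first by rewrite inE.
by case: (ribbon br s) IH => [|r T] //=; rewrite !inE !negb_or => /andP[].
Qed.

Lemma has_ribbon (p : pred A) br s : has (has p) (ribbon br s) = has p s.
Proof.
by rewrite -[in RHS](flatten_ribbon br s); elim: ribbon => //= r T ->; rewrite has_cat.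
Qed.

Lemma ribbon_ext br br' s :
  (forall s1 x y s2, s = s1 ++ x :: y :: s2 -> br x y = br' x y) ->
  ribbon br s = ribbon br' s.
Proof.
elim: s => //= x s IH E; rewrite -IH; last first.
  by move=> s1 x1 y s2 es; apply: (E (x :: s1) _ _ s2); rewrite es.
by case: s E {IH} => //= y s E; rewrite (E [::] x y s).
Qed.

Lemma ribbon_inj br br' s s' : ribbon br s = ribbon br' s' -> s = s' /\
  (forall s1 x y s2, s = s1 ++ x :: y :: s2 -> br x y = br' x y).
Proof.
move=> E; have es : s = s' by rewrite -(flatten_ribbon br s) E flatten_ribbon.
split=> //; move: E; rewrite -{}es.
elim: s {s'} => [|x s IH] /=; first by move=> _ [].
case: s IH => [|y s] IH E; first by move=> [|? [|? ?]].
set q := y :: s in IH E *.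
have cc T T' : [::] \notin T -> [::] \notin T' -> T != [::] -> T' != [::] ->
  cons_cell x T = cons_cell x T' -> T = T'.
  by case: T => // r T; case: T' => // r' T' _ _ _ _ [-> ->].
have nc T T' : [::] \notin T -> T != [::] -> [:: x] :: T' = cons_cell x T -> False.
  by case: T => // r T; rewrite inE negb_or => /andP[/eqP n _] _ [e]; case: n.
have nz b : ribbon b q != [::].
  by apply/eqP => /(congr1 flatten); rewrite flatten_ribbon.
have [eb eT] : br x y = br' x y /\ ribbon br q = ribbon br' q.
  move: E; rewrite /=.
  have := ribbon_nonempty br q; have := ribbon_nonempty br' q.
  have := nz br; have := nz br'.
  rewrite -/(ribbon br q) -/(ribbon br' q).
  case: (br x y) (br' x y) => [] [] n1 n2 n3 n4.
  - by case.
  - by move=> /nc -[].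
  - by move=> /esym /nc -[].
  - by move=> /cc -> //.
move=> [|x1 s1] x' y' s2; first by case=> <- <- _.
by case=> _; apply: IH eT _ _ _ _.
Qed.

Lemma insert_cons_cell x a T : x <= a ->
  KT_insert (cons_cell x T) a = cons_cell x (KT_insert T a).
Proof.
move=> xa; case: T => [|r T] /=; first by rewrite ltNge xa.
by case: ifP => //= _; rewrite ltNge xa.
Qed.

Lemma insert_low T a : [::] \notin T -> ~~ has (has (<= a)) T ->
  KT_insert T a = [:: a] :: T.
Proof.
case: T => //= -[|y r] T //=; rewrite inE /= => _.
by rewrite !negb_or -ltNge => /andP[/andP[ay _]] /negbTE ->; rewrite ay.
Qed.

Lemma insert_cons_row x a T : x <= a -> [::] \notin T ->
  KT_insert ([:: x] :: T) a =
    if has (has (<= a)) T then [:: x] :: KT_insert T a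
    else cons_cell x (KT_insert T a).
Proof.
move=> xa T0 /=; case: ifPn => // na.
by rewrite insert_low //= ltNge xa.
Qed.

Lemma insert_ribbon br br' a s : sorted <=%O s ->
  (forall y, y \in s -> a < y -> br' a y) ->
  (forall x y, x \in s -> y \in s -> (y <= a) || (a < x) -> br' x y = br x y) ->
  (forall x, x \in s -> x < a -> a \notin s -> ~~ br' x a) -> ~~ br' a a ->
  KT_insert (ribbon br s) a = ribbon br' (sorted_insert a s).
Proof.
move=> + + + + baa; elim: s => [|x s IH] //= ps H1 H2 H3.
have ss : sorted <=%O s by exact: path_sorted ps.
have xs : all (>= x) s by exact: (order_path_min le_trans ps).
case: (leP x a) => [xa|ax]; last first.
  rewrite -/(ribbon br (x :: s)).
  rewrite insert_low ?ribbon_nonempty //; last first.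
    rewrite has_ribbon /= negb_or -ltNge ax /=; apply/hasPn => y ys.
    by rewrite -ltNge (lt_le_trans ax) // (allP xs).
  rewrite /= H1 ?mem_head //; congr (_ :: _).
  rewrite -/(ribbon br (x :: s)) -/(ribbon br' (x :: s)).
  apply: ribbon_ext => s1 x1 y1 s2 es; apply/esym/H2; rewrite ?es;
    rewrite ?mem_cat ?inE ?eqxx ?orbT //.
  apply/orP; right.
  have: x1 \in x :: s by rewrite es mem_cat mem_head orbT.
  by rewrite inE => /orP[/eqP->//|/(allP xs)]; apply: lt_le_trans.
have {}IH : KT_insert (ribbon br s) a = ribbon br' (sorted_insert a s).
  apply: IH => //.
  - by move=> y ys; apply: H1; rewrite inE ys orbT.
  - by move=> u y us ys; apply: H2; rewrite inE ?us ?ys orbT.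
  - move=> u us ua an; apply: H3 => //; first by rewrite inE us orbT.
    rewrite inE negb_or an andbT; apply/eqP => eax; move: ua.
    by rewrite eax ltNge (allP xs).
have hs : has (has (<= a)) (ribbon br s) = breaks (fun _ y => y <= a) x s.
  rewrite has_ribbon; case: s ss {xs ps H1 H2 H3 IH} => //= y s ys.
  case: leP => //= ay; apply/negbTE/hasPn => z zs; rewrite -ltNge (lt_le_trans ay) //.
  by rewrite (allP (order_path_min le_trans ys)).
have bxa : (forall y, y \in s -> a < y) -> ~~ br' x a.
  move=> sa; move: xa; rewrite le_eqVlt => /orP[/eqP->//|xa].
  apply: H3; rewrite ?mem_head // inE negb_or gt_eqF //=.
  by apply/negP => /sa; rewrite ltxx.
have -> : KT_insert (if breaks br x s then [:: x] :: ribbon br s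
                 else cons_cell x (ribbon br s)) a =
          if breaks br x s && has (has (<= a)) (ribbon br s)
          then [:: x] :: KT_insert (ribbon br s) a
          else cons_cell x (KT_insert (ribbon br s) a).
  case: (breaks br x s); last by rewrite insert_cons_cell.
  by rewrite insert_cons_row ?ribbon_nonempty.
rewrite hs IH /=; congr (if _ then _ else _).
case: s ss xs ps H1 H2 H3 IH hs bxa => [|y s] ss xs ps H1 H2 H3 IH hs bxa /=.
  by apply/esym/negbTE/bxa.
case: leP => ya; rewrite /= ?andbT ?andbF.
  by apply/esym; rewrite H2 ?ya // !inE ?eqxx ?orbT.
apply/esym/negbTE/bxa => z; rewrite inE => /orP[/eqP->//|zs].
by rewrite (lt_le_trans ya) // (allP (order_path_min le_trans ss)).
Qed.

Lemma subseq2_cat x y u v :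
  subseq [:: y; x] (u ++ v) =
  [|| subseq [:: y; x] u, subseq [:: y; x] v | (y \in u) && (x \in v)].
Proof.
elim: u => [|z u IH]; first by rewrite /= orbF.
rewrite cat_cons [subseq _ (z :: u)]/= [LHS]/= inE.
case: (altP (y =P z)) => [yz|yz]; rewrite ?sub1seq ?mem_cat; last exact: IH.
rewrite /=; congr (_ || _); apply/idP/orP => [->|]; first by right.
case=> // /mem_subseq; apply; by rewrite !inE eqxx orbT.
Qed.

Lemma perm_sorted_insert a s : perm_eq (sorted_insert a s) (rcons s a).
Proof.
elim: s => //= y s IH; case: ifP => _; first by rewrite perm_cons.
by rewrite -rcons_cons perm_sym perm_rcons.
Qed.

Lemma sorted_sorted_insert a s :
  sorted <=%O s -> sorted <=%O (sorted_insert a s).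
Proof.
elim: s => //= y s IH ys; case: leP => [ya|/ltW ay] /=; last by rewrite ay.
rewrite (path_sortedE le_trans) IH ?(path_sorted ys) // andbT.
rewrite (perm_all _ (perm_sorted_insert a s)) all_rcons ya.
exact: (order_path_min le_trans ys).
Qed.

Lemma P_hypoE u : P_hypo u = ribbon (inversion u) (sort <=%O u).
Proof.
elim/last_ind: u => // u a IH.
rewrite /P_hypo foldl_rcons -/(P_hypo u) IH.
have -> : sort <=%O (rcons u a) = sorted_insert a (sort <=%O u).
  apply: (sorted_eq le_trans le_anti); rewrite ?sort_le_sorted //.
    by rewrite sorted_sorted_insert ?sort_le_sorted.
  rewrite perm_sort perm_sym (permPl (perm_sorted_insert _ _)).
  by rewrite -!cats1 perm_cat2r perm_sort.
have iE x y : inversion (rcons u a) x y =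
    inversion u x y || [&& x < y, y \in u & x == a].
  rewrite /inversion -cats1 subseq2_cat mem_seq1 -andb_orr /=.
  by case: (y == a).
apply: insert_ribbon; first exact: sort_le_sorted.
- by move=> y; rewrite mem_sort iE eqxx => -> ->; rewrite orbT.
- move=> x y _ _; rewrite iE; case: (altP (x =P a)); rewrite ?andbF ?orbF //.
  by move=> ->; rewrite ltxx orbF => ya; rewrite /inversion ltNge ya.
- move=> x _ xa; rewrite mem_sort iE lt_eqF // !andbF orbF => au.
  apply/negP => /andP[_ /mem_subseq /(_ a)]; rewrite mem_head (negbTE au).
  by move=> /(_ isT).
- by rewrite iE /inversion ltxx.
Qed.

Lemma P_hypo_quasi_ribbon u : quasi_ribbon (P_hypo u).
Proof.
rewrite P_hypoE /quasi_ribbon ribbon_nonempty /=.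
have: forall x y, inversion u x y -> x < y by move=> x y /andP[].
move: (inversion u) => br brlt; move: (sort_le_sorted u).
elim: (sort <=%O u) => // x s IH ps.
have /andP[] := IH (path_sorted ps); case: s ps {IH} => [|y s] //= + + +.
move=> /andP[xy _].
have [r [T ->]] : exists r T, (if breaks br y s then [:: y] :: ribbon br s
    else cons_cell y (ribbon br s)) = (y :: r) :: T.
  by case: ifP => _; [do 2 eexists|case: ribbon => [|r T]; do 2 eexists].
case: ifP => [/brlt xlty|_] /= e1 e2; first by rewrite e1 e2 andbT.
by rewrite xy e1 /=; case: (T) e2.
Qed.

Lemma consecutive_sort u x y : reflect
  (x < y /\ exists s1 s2, sort <=%O u = s1 ++ x :: y :: s2) (consecutive u x y).
Proof.
apply: (iffP and4P) => [[xu yu xy /allP m]|[xy [s1 [s2 es]]]].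
  split=> //.
  have ss := sort_le_sorted u.
  have {}xu : x \in sort <=%O u by rewrite mem_sort.
  have {}yu : y \in sort <=%O u by rewrite mem_sort.
  have {}m z : z \in sort <=%O u -> (z <= x) || (y <= z).
    by rewrite mem_sort; apply: m.
  elim: (sort <=%O u) ss xu yu m => //= z s IH zs xs ys m.
  have zm := allP (order_path_min le_trans zs).
  case: (boolP (x \in s)) => xs'.
    case: IH => //; first exact: path_sorted zs.
    - move: ys; rewrite inE => /orP[/eqP yz|//].
      by move: (zm _ xs'); rewrite -yz leNgt xy.
    - by move=> w ws; apply: m; rewrite inE ws orbT.
    by move=> s1 [s2 ->]; exists (z :: s1), s2.
  have {xs} zx : x = z by move: xs; rewrite inE (negbTE xs') orbF => /eqP.
  have {}ys : y \in s by move: ys; rewrite inE -zx gt_eqF.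
  case: s {IH} zs xs' ys zm m => // w s ws xs' ys zm m.
  exists [::], s; rewrite -zx; congr [:: _, _ & _].
  move: (ws) => /= /andP[zw ps].
  apply/le_anti/andP; split.
    move: ys; rewrite inE => /orP[/eqP->//|].
    exact: (allP (order_path_min le_trans ps)).
  have := m w; rewrite !inE eqxx orbT => /(_ isT) /orP[wx|//].
  have xw : x = w by apply/le_anti; rewrite wx zx zw.
  by move: xs'; rewrite inE xw eqxx.
have ss := sort_le_sorted u; rewrite es in ss.
have mu z : (z \in u) = (z \in s1 ++ x :: y :: s2) by rewrite -es mem_sort.
split; rewrite ?mu ?mem_cat ?inE ?eqxx ?orbT //.
apply/allP => z; rewrite mu mem_cat.
move: ss; rewrite (sorted_pairwise le_trans) pairwise_cat /=.
move=> /and3P[/allrelP h1 _ /and3P[_ h2 _]] /orP[/h1|].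
  by move=> ->; rewrite ?mem_head.
rewrite !inE => /or3P[/eqP->|/eqP->|/(allP h2)->]; by rewrite ?lexx ?orbT.
Qed.

(* Novelli's characterization of the hypoplactic congruence. *)
Lemma hypo_congP u v : hypo_cong u v <->
  perm_eq u v /\
  (forall x y, consecutive u x y -> subseq [:: y; x] u = subseq [:: y; x] v).
Proof.
rewrite /hypo_cong !P_hypoE; split.
  move=> /eqP /ribbon_inj [es E]; split.
    by rewrite -(permPl (permEl (perm_sort <=%O u))) es perm_sort.
  move=> x y /consecutive_sort [xy [s1 [s2 e]]].
  by move: (E _ _ _ _ e); rewrite /inversion xy.
move=> [puv E]; apply/eqP.
have -> : sort <=%O u = sort <=%O v by apply/perm_sort_leP.
apply: ribbon_ext => s1 x y s2 e; rewrite /inversion.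
case: ltP => //= xy; apply: E; apply/consecutive_sort; split=> //.
by exists s1, s2; rewrite -e; apply/perm_sort_leP.
Qed.

Lemma hypo_cong_cat u u' v v' :
  hypo_cong u u' -> hypo_cong v v' -> hypo_cong (u ++ v) (u' ++ v').
Proof.
move=> /hypo_congP [pu eu] /hypo_congP [pv ev]; apply/hypo_congP; split.
  exact: perm_cat.
move=> x y /and4P[xm ym xy]; rewrite all_cat => /andP[au av].
have sub w w' : perm_eq w w' -> all (fun z => (z <= x) || (y <= z)) w ->
    (forall x y, consecutive w x y -> subseq [:: y; x] w = subseq [:: y; x] w') ->
    subseq [:: y; x] w = subseq [:: y; x] w'.
  move=> pw aw E; case: (boolP (x \in w)) => xw; last first.
    have nw (w1 : seq A) : x \notin w1 -> subseq [:: y; x] w1 = false.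
      move=> n; apply/negP => /mem_subseq /(_ x); rewrite !inE eqxx orbT (negbTE n).
      by move=> /(_ isT).
    by rewrite !nw // -(perm_mem pw).
  case: (boolP (y \in w)) => yw; last first.
    have nw (w1 : seq A) : y \notin w1 -> subseq [:: y; x] w1 = false.
      move=> n; apply/negP => /mem_subseq /(_ y); rewrite !inE eqxx (negbTE n).
      by move=> /(_ isT).
    by rewrite !nw // -(perm_mem pw).
  by apply: E; rewrite /consecutive xw yw xy.
by rewrite !subseq2_cat (sub u u') // (sub v v') // (perm_mem pu) (perm_mem pv).
Qed.

End Tableaux.

Definition word (X : Type) : Type := seq X.

HB.instance Definition _ (X : choiceType) := Choice.on (word X).
HB.instance Definition _ (X : choiceType) :=
  isMonoid.Build (word X) (@catA X) (@cat0s X) (@cats0 X).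

Record letter := Letter {letter_val :> nat; letter_gt0 : 0 < letter_val}.

HB.instance Definition _ := [isSub for letter_val].
HB.instance Definition _ := [Countable of letter by <:].
HB.instance Definition _ :=
  [SubChoice_isSubOrder of letter by <: with Order.Disp tt tt].

Lemma hypo_cong_equiv : equiv_class_of (@hypo_cong _ letter).
Proof.
split=> [u|u v|v u w]; rewrite /hypo_cong ?eqxx //.
by move=> /eqP ->.
Qed.
Canonical hypo_equiv : equiv_rel (word letter) := EquivRelPack hypo_cong_equiv.

Local Open Scope quotient_scope.

Definition hypo : Type := {eq_quot hypo_equiv}.

HB.instance Definition _ := Choice.on hypo.
HB.instance Definition _ := EqQuotient.on hypo.

Definition hypo_mul (a b : hypo) : hypo :=
  \pi_hypo ((repr a ++ repr b) : word letter).

Lemma pi_hypo_mul (u v : word letter) :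
  hypo_mul (\pi_hypo u) (\pi_hypo v) = \pi_hypo ((u ++ v) : word letter).
Proof. by apply/eqmodP/hypo_cong_cat; apply/eqmodP; rewrite reprK. Qed.

Lemma hypo_mulA : associative hypo_mul.
Proof.
move=> a b c; rewrite -[a]reprK -[b]reprK -[c]reprK.
by rewrite (pi_hypo_mul (repr b)) (pi_hypo_mul (repr a) (repr b)) !pi_hypo_mul catA.
Qed.

Lemma hypo_mul1 : left_id (\pi_hypo ([::] : word letter)) hypo_mul.
Proof. by move=> a; rewrite -[a]reprK pi_hypo_mul. Qed.

Lemma hypo_mulr1 : right_id (\pi_hypo ([::] : word letter)) hypo_mul.
Proof. by move=> a; rewrite -[a]reprK pi_hypo_mul cats0. Qed.

HB.instance Definition _ := isMonoid.Build hypo hypo_mulA hypo_mul1 hypo_mulr1.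

Local Close Scope quotient_scope.
Local Open Scope group_scope.

Section DirectProduct.
Variables (I : Type) (M : I -> monoidType).

Definition direct_product : Type := forall i, M i.

HB.instance Definition _ := Choice.on direct_product.

Definition dprod_one : direct_product := fun i => 1.
Definition dprod_mul (f g : direct_product) : direct_product :=
  fun i => f i * g i.

Lemma dprod_mulA : associative dprod_mul.
Proof. by move=> f g h; apply: functional_extensionality_dep => i; exact: mulgA. Qed.

Lemma dprod_mul1 : left_id dprod_one dprod_mul.
Proof. by move=> f; apply: functional_extensionality_dep => i; exact: mul1g. Qed.

Lemma dprod_mulr1 : right_id dprod_one dprod_mul.
Proof. by move=> f; apply: functional_extensionality_dep => i; exact: mulg1. Qed.

HB.instance Definition _ :=
  isMonoid.Build direct_product dprod_mulA dprod_mul1 dprod_mulr1.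

End DirectProduct.

Notation monoid_hom := UMagmaMorphism.type.

(* Bundling a choice structure in monoidType does not restrict these classes:
   boolp.gen_choiceMixin provides one on any carrier. *)
Definition monoid_class := monoidType -> Prop.

Record monoid_variety (V : monoid_class) : Prop := MonoidVariety {
  variety_image : forall (M N : monoidType) (f : monoid_hom M N),
    (forall b : N, exists a : M, f a = b) -> V M -> V N;
  variety_submonoid : forall (M : monoidType) (S : pred M) (N : subMonoidType S),
    V M -> V N;
  variety_product : forall (I : Type) (M : I -> monoidType),
    (forall i, V (M i)) -> V (direct_product M)
}.

Definition generated_variety (M : monoidType) : monoid_class :=
  fun N => forall V : monoid_class, monoid_variety V -> V M -> V N.

Lemma generated_variety_is_variety (M : monoidType) :
  monoid_variety (generated_variety M).
Proof.
split.
- by move=> A B f fs VA V HV VM; apply: (variety_image HV fs); apply: VA.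
- by move=> A S B VA V HV VM; apply: (variety_submonoid HV); apply: VA.
- by move=> I F VF V HV VM; apply: (variety_product HV) => i; apply: VF.
Qed.

Section Identities.
Variable X : choiceType.

(* The pair (u, v) stands for the identity u ≈ v. *)
Definition identity : Type := word X * word X.

Definition satisfies (M : monoidType) (e : identity) : Prop :=
  forall psi : monoid_hom (word X) M, psi e.1 = psi e.2.

Definition equational_theory (V : monoid_class) : set identity :=
  [set e | forall M : monoidType, V M -> satisfies M e].

Definition rewrite_step (Sigma : set identity) (w w' : word X) : Prop :=
  exists (sigma : monoid_hom (word X) (word X)) (p q r s : word X),
    [/\ Sigma (p, q) \/ Sigma (q, p),
        w = r * sigma p * s &
        w' = r * sigma q * s].

Definition consequences (Sigma : set identity) : set identity :=
  [set e | exists (k : nat) (w : nat -> word X),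
    [/\ w 0 = e.1, w k = e.2 &
        forall i, i < k -> rewrite_step Sigma (w i) (w i.+1)]].

Definition is_basis (V : monoid_class) (B : set identity) : Prop :=
  equational_theory V = consequences B.

Definition hypo_basis (x y z t : X) : set identity :=
  [set ([:: x; y; z; x; t; y], [:: y; x; z; x; t; y]);
       ([:: x; z; x; y; t; x], [:: x; z; y; x; t; x]);
       ([:: x; z; y; t; x; y], [:: x; z; y; t; y; x])]%classic.

End Identities.

(* Main.v *)
(* An identity u ≈ v holds in the hypoplactic monoid iff u and v have the same
   content and the same scattered subwords of length two: by Novelli's
   characterization these data determine the hypoplactic class of every
   substitution instance, and sending p, q to the letters 2, 1 and the other
   variables to the empty word detects the subword pq. The three basic
   identities commute two adjacent variables p q whenever both occur earlier,
   both occur later, or one of them occurs both earlier and later; these are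
   exactly the adjacent transpositions that preserve the invariant. If u and v
   share the invariant and agree on a prefix after which v continues with p,
   the next p of u can be moved left to that place by such transpositions, so
   u is transformed into v by induction on the rest of v. *)

Require Import Defs.
From HB Require Import structures.
From mathcomp Require Import all_boot all_order.
From mathcomp Require Import boolp classical_sets cardinality.

Set Implicit Arguments.
Unset Strict Implicit.
Unset Printing Implicit Defensive.

Local Open Scope group_scope.

(** * Homomorphisms out of a free monoid *)

Section FreeMonoid.
Variables (X : choiceType) (M : monoidType).

Definition word_ext (f : X -> M) (w : word X) : M := \prod_(a <- w) f a.

Section WordExt.
Variable f : X -> M.

Lemma word_extM : {morph word_ext f : u v / u * v}.
Proof. by move=> u v; rewrite /word_ext big_cat. Qed.

Lemma word_ext1 : word_ext f 1 = 1.
Proof. exact: big_nil. Qed.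

HB.instance Definition _ :=
  isMultiplicative.Build (word X) M (word_ext f) word_extM.
HB.instance Definition _ :=
  Multiplicative_isUMagmaMorphism.Build (word X) M (word_ext f) word_ext1.

Definition word_hom : monoid_hom (word X) M := word_ext f.

End WordExt.

Lemma word_homE f w : word_hom f w = \prod_(a <- w) f a.
Proof. by []. Qed.

Lemma word_hom_unique (psi : monoid_hom (word X) M) w :
  psi w = word_hom (fun a => psi ([:: a] : word X)) w.
Proof.
rewrite word_homE; elim: w => [|a w IH]; first by rewrite big_nil; exact: gmulf1.
by rewrite big_cons -IH -gmulfM.
Qed.

End FreeMonoid.

(** * Varieties, equational theories and soundness of consequences *)

Section EquationalTheory.
Variable X : choiceType.
Implicit Types (e : identity X) (Sigma : set (identity X)) (u v w : word X).

Lemma satisfies_word_hom (M : monoidType) e :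
  satisfies M e <-> forall f : X -> M, word_hom f e.1 = word_hom f e.2.
Proof.
by split=> [S f|S psi]; [exact: S | rewrite !(word_hom_unique psi)].
Qed.

Lemma satisfies_variety e : monoid_variety (fun M => satisfies M e).
Proof.
split.
- move=> M N f fsurj Me; apply/satisfies_word_hom => g.
  (* Choosing preimages under the surjection [f] lifts the assignment [g] to one with values in
     [M]. *)
  have [h hP] := boolp.choice (fun x => fsurj (g x)).
  have E w : word_hom g w = f (word_hom h w).
    by rewrite !word_homE gmulf_prod; apply: eq_bigr => x _; rewrite hP.
  by rewrite !E Me.
- move=> M S N Me psi; apply: val_inj.
  exact: (Me (\val \o psi : monoid_hom (word X) M)).
- move=> I M Me; apply/satisfies_word_hom => g.
  have E w i : word_hom g w i = word_hom (fun x => g x i) w.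
    rewrite !word_homE; elim: w => [|x w IH]; first by rewrite !big_nil.
    by rewrite !big_cons -IH.
  by apply: functional_extensionality_dep => i; rewrite !E Me.
Qed.

(** The models of a single identity form a variety; if [M] is among them, so is everything [M]
    generates. *)
Lemma equational_theory_generated (M : monoidType) e :
  equational_theory (generated_variety M) e <-> satisfies M e.
Proof.
split=> [H|Me N NV]; first by apply: (H M) => V HV VM.
exact: (NV _ (satisfies_variety e)).
Qed.

Lemma consequences_sound (M : monoidType) Sigma :
  (forall e, Sigma e -> satisfies M e) ->
  forall e, consequences Sigma e -> satisfies M e.
Proof.
move=> S [u v] [k [w [/= <- <- step]]] psi /=.
elim: k step => // k IH step; rewrite IH => [|i ik]; last exact/step/ltnW.
have [sigma [p [q [r [s [pq -> ->]]]]]] := step k (ltnSn k).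
rewrite !gmulfM; congr (_ * _ * _).
have sat e : Sigma e -> psi (sigma e.1) = psi (sigma e.2).
  by move=> /S /(_ (psi \o sigma : monoid_hom (word X) M)).
by case: pq => /sat.
Qed.

Lemma rewrite_step_sym Sigma u v :
  rewrite_step Sigma u v -> rewrite_step Sigma v u.
Proof.
move=> [sigma [p [q [r [s [pq -> ->]]]]]]; exists sigma, q, p, r, s.
by split=> //; case: pq; [right|left].
Qed.

Lemma consequences_refl Sigma u : consequences Sigma (u, u).
Proof. by exists 0, (fun=> u). Qed.

Lemma consequences_step Sigma u v w :
  rewrite_step Sigma u v -> consequences Sigma (v, w) -> consequences Sigma (u, w).
Proof.
move=> uv [k [c [/= c0 ck step]]].
exists k.+1, (fun i => if i is j.+1 then c j else u); split=> //.
by case=> [_|i] /=; [rewrite c0 | exact: step].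
Qed.

End EquationalTheory.

(** * Scattered subwords of length two *)

Definition same_subseq2 (T : eqType) (u v : seq T) :=
  perm_eq u v /\ forall p q, subseq [:: p; q] u = subseq [:: p; q] v.

Lemma subseq2_mem (T : eqType) (p q : T) w :
  subseq [:: p; q] w -> p \in w /\ q \in w.
Proof. by move=> /mem_subseq s; split; apply: s; rewrite !inE eqxx ?orbT. Qed.

Lemma subseq2_cons (T : eqType) (p q a : T) w :
  subseq [:: p; q] (a :: w) = (p == a) && (q \in w) || subseq [:: p; q] w.
Proof.
rewrite /=; case: eqVneq => [_|_] //=; rewrite sub1seq.
by apply/esym/orb_idr => /subseq2_mem[].
Qed.

(* [subseq2_cat] requires an ordered alphabet, which variables do not have. *)
Lemma subseq_pair_cat (T : eqType) (p q : T) u v :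
  subseq [:: p; q] (u ++ v) =
  [|| subseq [:: p; q] u, subseq [:: p; q] v | (p \in u) && (q \in v)].
Proof.
elim: u => [|a u IH]; first by rewrite /= orbF.
rewrite cat_cons !subseq2_cons IH mem_cat inE.
by case: (p == a) (q \in u) (q \in v) (p \in u) => [] [] [] []; rewrite /= ?orbT.
Qed.

(** The two chosen letters lie in one block or in two blocks at different positions, where [p = q]
    is possible. Hence the invariant of a word controls the inversions of all its substitution
    instances. *)
Lemma subseq2_flatten (T S : eqType) (f : T -> seq S) (b c : S) (u : seq T) :
  reflect ((exists2 p, p \in u & subseq [:: b; c] (f p)) \/
           (exists p q, [/\ subseq [:: p; q] u, b \in f p & c \in f q]))
          (subseq [:: b; c] (flatten (map f u))).
Proof.
elim: u => [|a u IH]; first by right; case=> [[]|[p [q []]]].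
rewrite map_cons [flatten _]/= -[flatten _]/(flatten (map f u)) subseq_pair_cat.
apply: (iffP or3P) => [[H|/IH [[p pu H]|[p [q [pq bp cq]]]]|]|].
- by left; exists a; rewrite ?mem_head.
- by left; exists p; rewrite // inE pu orbT.
- right; exists p, q; split=> //; exact: subseq_trans pq (subseq_cons _ _).
- move=> /andP[ba /flattenP [_ /mapP [q qu ->] cq]].
  by right; exists a, q; rewrite /= eqxx sub1seq.
- case=> [[p]|[p [q [/=]]]].
    rewrite inE => /orP[/eqP -> H|pu H]; first by constructor 1.
    by constructor 2; apply/IH; left; exists p.
  case: eqP => [->|_] pq bp cq; last first.
    by constructor 2; apply/IH; right; exists p, q.
  constructor 3; rewrite bp; apply/flattenP; exists (f q) => //.
  by rewrite map_f // -sub1seq.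
Qed.

(** * The identities satisfied by the hypoplactic monoid *)

Section Hypo.
Variable X : choiceType.
Implicit Types (u v w : word X).

Lemma word_hom_hypo (g : X -> word letter) w :
  word_hom (fun x => \pi_hypo (g x) : hypo)%qT w =
  (\pi_hypo (flatten (map g w) : word letter))%qT.
Proof.
rewrite word_homE; elim: w => [|x w IH]; first by rewrite big_nil.
by rewrite big_cons IH; exact: pi_hypo_mul.
Qed.

Lemma satisfies_hypo_cong u v : satisfies hypo (u, v) <->
  forall g : X -> word letter, hypo_cong (flatten (map g u)) (flatten (map g v)).
Proof.
rewrite satisfies_word_hom; split=> /= [S g|S f].
  by have := S (fun x => \pi_hypo (g x))%qT; rewrite !word_hom_hypo => /eqmodP.
have -> : f = (fun x => \pi_hypo (repr (f x) : word letter))%qT.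
  by apply: functional_extensionality_dep => x; rewrite reprK.
by rewrite !word_hom_hypo; apply/eqmodP/S.
Qed.

Lemma satisfies_hypo u v : satisfies hypo (u, v) <-> same_subseq2 u v.
Proof.
rewrite satisfies_hypo_cong; split=> [S|[puv suv] g]; last first.
  apply/hypo_congP; split=> [|b c _]; first exact/perm_flatten/perm_map.
  apply/subseq2_flatten/subseq2_flatten.
    case=> [[p pu H]|[p [q [pq H]]]]; [left|right].
      by exists p; rewrite // -(perm_mem puv).
    by exists p, q; rewrite -suv.
  case=> [[p pu H]|[p [q [pq H]]]]; [left|right].
    by exists p; rewrite // (perm_mem puv).
  by exists p, q; rewrite suv.
pose l1 := @Letter 1 isT; pose l2 := @Letter 2 isT.
have puv : perm_eq u v.
  (* Erasing every variable but [p] turns length into the number of occurrences of [p]. *)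
  apply/allP => p _ /=; pose g x : word letter := if x == p then [:: l1] else [::].
  have /hypo_congP [/perm_size + _] := S g.
  have E w : size (flatten (map g w)) = count_mem p w.
    by elim: w => //= x w IH; rewrite size_cat IH /g; case: (x == p).
  by rewrite !E => ->.
split=> // p q.
case: (eqVneq p q) => [<-|pq].
  have E w : subseq [:: p; p] w = (1 < count_mem p w).
    elim: w => //= x w IH; rewrite eq_sym; case: eqVneq => _; last exact: IH.
    by rewrite sub1seq -has_pred1 has_count.
  by rewrite !E; move/permP: puv => ->.
case: (boolP (p \in u)) => pu; last first.
  have E w : p \notin w -> subseq [:: p; q] w = false.
    by move=> pw; apply/negP => /subseq2_mem [/(negP pw)].
  by rewrite !E // -(perm_mem puv).
case: (boolP (q \in u)) => qu; last first.
  have E w : q \notin w -> subseq [:: p; q] w = false.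
    by move=> qw; apply/negP => /subseq2_mem [_ /(negP qw)].
  by rewrite !E // -(perm_mem puv).
(* Only the letters 1 and 2 survive, so they are consecutive in the support once [p] and [q] both
   occur; this is why missing variables were treated first. *)
pose g x : word letter := if x == p then [:: l2] else if x == q then [:: l1] else [::].
have gp x : (l2 \in g x) = (x == p).
  by rewrite /g; case: (x == p) => //; case: (x == q).
have gq x : (l1 \in g x) = (x == q).
  rewrite /g; case: (eqVneq x p) => [->|_]; first by rewrite (negbTE pq).
  by case: (x == q).
have E w : subseq [:: l2; l1] (flatten (map g w)) = subseq [:: p; q] w.
  apply/subseq2_flatten/idP => [[[x _]|[x [y []]]]|H].
  - by rewrite /g; case: (x == p) => //; case: (x == q).
  - by rewrite gp gq => + /eqP <- /eqP <-.
  - by right; exists p, q; rewrite gp gq !eqxx.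
have /hypo_congP [_ /(_ l1 l2)] := S g; rewrite !E; apply.
apply/and4P; split=> //.
- by apply/flattenP; exists (g q); rewrite ?gq ?map_f.
- by apply/flattenP; exists (g p); rewrite ?gp ?map_f.
- apply/allP => z /flattenP [_ /mapP [x _ ->]]; rewrite /g.
  case: (x == p); [|case: (x == q)] => //; rewrite inE => /eqP ->;
  by rewrite Order.POrderTheory.lexx ?orbT.
Qed.

End Hypo.

(** * Derivations from the three basic identities *)

Section Basis.
Variables (X : choiceType) (x y z t : X).
Hypothesis xyzt : uniq [:: x; y; z; t].
Implicit Types (p q : X) (a b c d u v w : word X).
Local Notation B := (hypo_basis x y z t).

Definition subst4 a b c d : X -> word X := fun s =>
  if s == x then a else if s == y then b else if s == z then c else
  if s == t then d else [::].

Lemma subst4E a b c d :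
  [/\ subst4 a b c d x = a, subst4 a b c d y = b,
      subst4 a b c d z = c & subst4 a b c d t = d].
Proof.
move: xyzt; rewrite /= !inE !negb_or -!andbA => /and5P[xy xz xt yz /and3P[yt zt _]].
rewrite /subst4 !eqxx [y == x]eq_sym [z == x]eq_sym [t == x]eq_sym.
rewrite [z == y]eq_sym [t == y]eq_sym [t == z]eq_sym.
by rewrite (negbTE xy) (negbTE xz) (negbTE xt) (negbTE yz) (negbTE yt) (negbTE zt).
Qed.

Lemma basis_step (e : identity X) r s a b c d :
  B e -> rewrite_step B (r ++ word_hom (subst4 a b c d) e.1 ++ s)
                        (r ++ word_hom (subst4 a b c d) e.2 ++ s).
Proof.
case: e => u v Be; exists (word_hom (subst4 a b c d)), u, v, r, s.
by split; [left | rewrite catA | rewrite catA].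
Qed.

Lemma word_mulE u v : u * v = u ++ v.
Proof. by []. Qed.

(** Here and in the next two lemmas [x] and [y] become single letters, while [z] and [t] absorb the
    arbitrary, possibly empty, words between them. *)
Lemma step_before p q r c d s :
  rewrite_step B (r ++ [:: p, q & c ++ p :: d ++ q :: s])
                 (r ++ [:: q, p & c ++ p :: d ++ q :: s]).
Proof.
have := @basis_step ([:: x; y; z; x; t; y], [:: y; x; z; x; t; y])
  r s [:: p] [:: q] c d (or_introl (or_introl erefl)).
rewrite !word_homE !big_cons big_nil; have [-> -> -> ->] := subst4E [:: p] [:: q] c d.
by rewrite mulg1 !word_mulE /= -!catA /= -?catA.
Qed.

Lemma step_between p q r c d s :
  rewrite_step B (r ++ p :: c ++ [:: p, q & d ++ p :: s])
                 (r ++ p :: c ++ [:: q, p & d ++ p :: s]).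
Proof.
have := @basis_step ([:: x; z; x; y; t; x], [:: x; z; y; x; t; x])
  r s [:: p] [:: q] c d (or_introl (or_intror erefl)).
rewrite !word_homE !big_cons big_nil; have [-> -> -> ->] := subst4E [:: p] [:: q] c d.
by rewrite mulg1 !word_mulE /= -!catA /= -?catA.
Qed.

Lemma step_after p q r c d s :
  rewrite_step B (r ++ p :: c ++ q :: d ++ [:: p, q & s])
                 (r ++ p :: c ++ q :: d ++ [:: q, p & s]).
Proof.
have := @basis_step ([:: x; z; y; t; x; y], [:: x; z; y; t; y; x])
  r s [:: p] [:: q] c d (or_intror erefl).
rewrite !word_homE !big_cons big_nil; have [-> -> -> ->] := subst4E [:: p] [:: q] c d.
by rewrite mulg1 !word_mulE /= -!catA /= -?catA.
Qed.

Lemma mem_split p w : p \in w -> exists a b, w = a ++ p :: b.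
Proof. by case/splitPr => a b; exists a, b. Qed.

Lemma mem_split2 p q w : p != q -> p \in w -> q \in w -> exists a b c,
  w = a ++ p :: b ++ q :: c \/ w = a ++ q :: b ++ p :: c.
Proof.
move=> pq /mem_split [a [b ->]]; rewrite mem_cat inE eq_sym (negbTE pq) /=.
case/orP => /mem_split [c [d ->]]; first by exists c, d, b; right; rewrite -catA.
by exists a, c, d; left.
Qed.

(** The first disjunction makes [pq] survive the swap, the second makes [qp] present before it. The
    four combinations are instances of the basic identities, up to direction and exchange of [p] and
    [q]. *)
Lemma step_swap p q u v : p != q ->
  (p \in u) || (q \in v) -> (q \in u) || (p \in v) ->
  rewrite_step B (u ++ [:: p, q & v]) (u ++ [:: q, p & v]).
Proof.
move=> pq /orP[pu|qv] /orP[qu|pv].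
- have [a [b [c [] ->]]] := mem_split2 pq pu qu; rewrite -!catA /= -!catA.
    exact: step_after.
  exact/rewrite_step_sym/step_after.
- have [a [b ->]] := mem_split pu; have [c [d ->]] := mem_split pv.
  by rewrite -!catA; exact: step_between.
- have [a [b ->]] := mem_split qu; have [c [d ->]] := mem_split qv.
  by rewrite -!catA; exact/rewrite_step_sym/step_between.
- have [a [b [c [] ->]]] := mem_split2 pq pv qv.
    exact: step_before.
  exact/rewrite_step_sym/step_before.
Qed.

Lemma basis_hypo e : B e -> satisfies hypo e.
Proof.
case=> [[->|->]|->]; apply/satisfies_hypo; split;
  try by apply/permP => P /=; case: (P x) (P y) (P z) (P t) => [] [] [] [].
(* What remains is a Boolean equality in eight equality tests, valid for every assignment of truth
   values. *)
all: move=> p q; rewrite !subseq2_cons !inE; move: (p == x) (p == y) (p == z) (p == t).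
all: by move: (q == x) (q == y) (q == z) (q == t); do 8 case.
Qed.

Lemma consequences_same_subseq2 u v : consequences B (u, v) -> same_subseq2 u v.
Proof. by move=> /(consequences_sound basis_hypo) /satisfies_hypo. Qed.

Lemma mem_split_first p w : p \in w -> exists a b, p \notin a /\ w = a ++ p :: b.
Proof.
elim: w => // q w IH; rewrite inE; case: eqVneq => [-> _|pq /= /IH [a [b [pa ->]]]].
  by exists [::], w.
by exists (q :: a), b; rewrite inE negb_or pq.
Qed.

(* The first [p] of the left-hand word can be moved left across [q]: otherwise
   the two words would differ in the subsequences [p q] or [q p]. *)
Lemma swap_toward p q r u v w : p \notin u -> p != q ->
  same_subseq2 (r ++ u ++ [:: q, p & v]) (r ++ p :: w) ->
  rewrite_step B (r ++ u ++ [:: q, p & v]) (r ++ u ++ [:: p, q & v]).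
Proof.
move=> pu pq [puw suw]; rewrite !(catA r).
have perm_w : perm_eq (u ++ q :: v) w.
  rewrite -(perm_cons p); move: puw; rewrite perm_cat2l => /permPr <-.
  by apply/permP => P; rewrite /= !count_cat /= (addnCA (P q)) addnCA.
apply: step_swap; first by rewrite eq_sym.
  (* If this fails, [qp] occurs on the left; on the right [q] is not in [r], so a second [p] would
     lie in [w], which has none. *)
  apply/contraT; rewrite negb_or mem_cat negb_or => /andP[/andP[qr qu] pv].
  have : subseq [:: q; p] (r ++ p :: w).
    by rewrite -suw catA subseq_pair_cat subseq2_cons eqxx mem_head /= orbT.
  rewrite subseq_pair_cat subseq2_cons eq_sym (negbTE pq) (negbTE qr) orbF /=.
  move=> /orP[] /subseq2_mem.
    by rewrite (negbTE qr) => -[].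
  case=> _; rewrite -(perm_mem perm_w) mem_cat inE.
  by rewrite (negbTE pu) (negbTE pq) (negbTE pv).
(* If this fails, [pq] occurs on the right, but on the left no [q] follows a [p]. *)
apply/contraT; rewrite negb_or => /andP[pru qv].
have : subseq [:: p; q] (r ++ u ++ [:: q, p & v]).
  rewrite suw subseq_pair_cat subseq2_cons eqxx -(perm_mem perm_w).
  by rewrite mem_cat mem_head !orbT.
rewrite catA subseq_pair_cat !subseq2_cons (negbTE pq) (negbTE pru) orbF /=.
by rewrite (negbTE qv) andbF => /orP[] /subseq2_mem[];
  rewrite ?(negbTE pru) ?(negbTE qv).
Qed.

Lemma same_subseq2_left_trans u v w :
  same_subseq2 u v -> same_subseq2 u w -> same_subseq2 v w.
Proof.
move=> [puv suv] [puw suw]; split; first by rewrite -(permPl puv).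
by move=> p q; rewrite -suv.
Qed.

(** The common prefix [r] is kept because the invariant does not pass to suffixes, and the swaps may
    rely on letters of [r]. *)
Lemma consequences_prefix r u v :
  same_subseq2 (r ++ u) (r ++ v) -> consequences B (r ++ u, r ++ v).
Proof.
elim: v r u => [|p v IH] r u.
  move=> [/perm_size + _]; rewrite cats0 size_cat -[RHS]addn0.
  move=> /addnI/size0nil ->; rewrite cats0; exact: consequences_refl.
(* Taking the first [p] of [u] makes it differ from every letter it must cross. *)
move=> Huv; have [a [b [pa eu]]] : exists a b, p \notin a /\ u = a ++ p :: b.
  apply: mem_split_first; case: Huv => + _; rewrite perm_cat2l => /perm_mem ->.
  exact: mem_head.
rewrite {u}eu in Huv *; elim/last_ind: a b pa Huv => [|a q IHa] b.
  (* Once [p] is adjacent to [r], it joins the common prefix. *)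
  by move=> _; rewrite /= -!cat_rcons; exact: IH.
rewrite mem_rcons inE negb_or cat_rcons => /andP[pq pa] Huv.
have step := swap_toward pa pq Huv.
apply: (consequences_step step); apply: IHa => //.
(* By soundness the swap preserves the invariant, so the inner induction on [a] can continue. *)
apply: same_subseq2_left_trans Huv.
exact/consequences_same_subseq2/(consequences_step step)/consequences_refl.
Qed.

Lemma consequences_basis u v : consequences B (u, v) <-> same_subseq2 u v.
Proof.
split; first exact: consequences_same_subseq2.
exact: (@consequences_prefix [::]).
Qed.

End Basis.

Theorem theorem4p8 (X : choiceType) (X_infinite : infinite_set [set: X]%classic)
    (x y z t : X) (xyzt_distinct : uniq [:: x; y; z; t]) :
  finite_set (hypo_basis x y z t) /\
  is_basis (generated_variety hypo) (hypo_basis x y z t).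
Proof.
split; first by rewrite /hypo_basis !finite_setU; do !split; exact: finite_set1.
apply/seteqP; split=> -[u v].
  by move=> /equational_theory_generated/satisfies_hypo/consequences_basis; apply.
by move=> /consequences_basis/satisfies_hypo/equational_theory_generated; apply.
Qed.
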